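(* Assume the continuum hypothesis. Then there exists a smooth compactification $\gamma\omega$ of $\omega$ such that the remainder $\gamma\omega\setminus\omega$ is not separable.
   Context: $\omega$ is the discrete space of natural numbers; compactifications are Hausdorff. $C(K)$ is the Banach space of real-valued continuous functions on a compact space $K$ with the supremum norm. For a compactification $\gamma\omega$ of $\omega$, the natural copy of $c_0$ in $C(\gamma\omega)$ is the closed subspace $\{f\in C(\gamma\omega): f|(\gamma\omega\setminus\omega)\equiv 0\}$. The compactification $\gamma\omega$ is called smooth if the natural copy of $c_0$ is complemented in $C(\gamma\omega)$, i.e. is the range of a bounded linear projection on $C(\gamma\omega)$. *)

(* Defs.v *)
From HB Require Import structures.
From mathcomp Require Import all_boot all_order all_algebra.
From mathcomp Require Import all_classical all_reals all_analysis.
From mathcomp Require Import ring.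

Set Implicit Arguments.
Unset Strict Implicit.
Unset Printing Implicit Defensive.

Import Order.TTheory GRing.Theory Num.Theory.
Import numFieldNormedType.Exports.

Local Open Scope classical_set_scope.
Local Open Scope ring_scope.
Local Open Scope card_scope.

(* The ordinal-free form of 2^aleph_0 = aleph_1: no cardinality lies strictly
   between that of nat and that of its power set. *)
Definition continuum_hypothesis : Prop :=
  forall A : set (set nat), countable A \/ A #= [set: set nat].

Definition separable (T : topologicalType) : Prop :=
  exists2 D : set T, countable D & dense D.

Definition topological_embedding (X Y : topologicalType) (f : X -> Y) : Prop :=
  [/\ injective f, continuous f &
      forall A : set X, open A -> exists2 U : set Y, open U & f @^-1` U = A].

(* nat carries its canonical (discrete) topology. *)
Record nat_compactification := NatCompactification {
  compactification_space :> topologicalType ;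
  nat_emb : nat -> compactification_space ;
  compactification_compact : compact [set: compactification_space] ;
  compactification_hausdorff : hausdorff_space compactification_space ;
  nat_emb_embedding : topological_embedding nat_emb ;
  nat_emb_dense : dense (range nat_emb) }.
Arguments nat_emb n : clear implicits.
Arguments compactification_compact n : clear implicits.

(* As a type this is the subtype set_type, with the subspace topology. *)
Definition remainder (g : nat_compactification) : set g := ~` range (nat_emb g).
Arguments remainder g : clear implicits.

(* C(K); compactness is a parameter because it makes the supremum norm
   finite. *)
Definition contfun (R : realType) (K : topologicalType)
  (cK : compact [set: K]) : Type := continuousType K R.

Section contfun_lmodule.
Context {R : realType} {K : topologicalType} {cK : compact [set: K]}.
Local Notation CK := (contfun R cK).

HB.instance Definition _ := Choice.on CK.

Lemma contfun_continuous (f : CK) : continuous f.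
Proof. exact: cts_fun. Qed.

Lemma contfunP (f g : CK) : f =1 g -> f = g.
Proof. by move/continuousEP. Qed.

Definition Contfun (f : K -> R) (cf : continuous f) : CK :=
  (mkcts cf : continuousType K R).

Definition contfun_zero : CK := Contfun (fun x => cvg_cst (0 : R)).

Definition contfun_opp (f : CK) : CK :=
  @Contfun (fun x => - f x) (fun x => cvgN (@contfun_continuous f x)).

Definition contfun_add (f g : CK) : CK :=
  @Contfun (fun x => f x + g x)
    (fun x => cvgD (@contfun_continuous f x) (@contfun_continuous g x)).

Definition contfun_scale (a : R) (f : CK) : CK :=
  @Contfun (fun x => a * f x)
    (fun x => cvgM (cvg_cst a) (@contfun_continuous f x)).

Lemma contfun_addA : associative contfun_add.
Proof. by move=> f g h; apply: contfunP => x; exact: addrA. Qed.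

Lemma contfun_addC : commutative contfun_add.
Proof. by move=> f g; apply: contfunP => x; exact: addrC. Qed.

Lemma contfun_add0 : left_id contfun_zero contfun_add.
Proof. by move=> f; apply: contfunP => x; exact: add0r. Qed.

Lemma contfun_addN : left_inverse contfun_zero contfun_opp contfun_add.
Proof. by move=> f; apply: contfunP => x; exact: addNr. Qed.

HB.instance Definition _ := GRing.isZmodule.Build CK
  contfun_addA contfun_addC contfun_add0 contfun_addN.

Lemma contfun_scaleA (a b : R) (f : CK) :
  contfun_scale a (contfun_scale b f) = contfun_scale (a * b) f.
Proof. by apply: contfunP => x; exact: mulrA. Qed.

Lemma contfun_scale1 : left_id 1 contfun_scale.
Proof. by move=> f; apply: contfunP => x; exact: mul1r. Qed.

Lemma contfun_scaleDr : right_distributive contfun_scale +%R.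
Proof. by move=> a f g; apply: contfunP => x; exact: mulrDr. Qed.

Lemma contfun_scaleDl (f : CK) : {morph contfun_scale^~ f : a b / a + b}.
Proof. by move=> a b; apply: contfunP => x; exact: mulrDl. Qed.

HB.instance Definition _ := GRing.Zmodule_isLmodule.Build R CK
  contfun_scaleA contfun_scale1 contfun_scaleDr contfun_scaleDl.

Lemma contfunD (f g : CK) x : (f + g) x = f x + g x. Proof. by []. Qed.
Lemma contfunN (f : CK) x : (- f) x = - f x. Proof. by []. Qed.
Lemma contfunZ (a : R) (f : CK) x : (a *: f) x = a * f x. Proof. by []. Qed.
Lemma contfun0 x : (0 : CK) x = 0. Proof. by []. Qed.

(* For empty K this is sup set0 = 0. *)
Definition contfun_norm (f : CK) : R := sup [set `|f x| | x in [set: K]].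

Lemma contfun_bounded (f : CK) : has_ubound [set `|f x| | x in [set: K]].
Proof.
have [M [_ /(_ (M + 1))]] : bounded_set (f @` [set: K]).
  apply: compact_bounded; apply: continuous_compact => //.
  by apply: continuous_subspaceT; exact: contfun_continuous.
by rewrite ltrDl ltr01 => /(_ isT) fM; exists (M + 1) => _ [x _ <-]; apply: fM; exists x.
Qed.

Lemma contfun_norm_ge (f : CK) x : `|f x| <= contfun_norm f.
Proof.
by apply: ub_le_sup; [exact: contfun_bounded | exists x].
Qed.

Lemma contfun_norm_le (f : CK) (M : R) :
  0 <= M -> (forall x, `|f x| <= M) -> contfun_norm f <= M.
Proof.
move=> M0 fM; rewrite /contfun_norm.
have [->|/set0P A0] := eqVneq [set `|f x| | x in [set: K]] set0.
  by rewrite sup0.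
by apply: ge_sup => // _ [x _ <-].
Qed.

Lemma contfun_norm_ge0 (f : CK) : 0 <= contfun_norm f.
Proof.
rewrite /contfun_norm.
have [->|/set0P [_ [x _ _]]] := eqVneq [set `|f x| | x in [set: K]] set0.
  by rewrite sup0.
exact: le_trans (normr_ge0 (f x)) (contfun_norm_ge f x).
Qed.

Lemma contfun_ler_normD (f g : CK) :
  contfun_norm (f + g) <= contfun_norm f + contfun_norm g.
Proof.
apply: contfun_norm_le => [|x]; first by rewrite addr_ge0// contfun_norm_ge0.
by rewrite (le_trans (ler_normD _ _))// lerD// contfun_norm_ge.
Qed.

Lemma contfun_normZ (a : R) (f : CK) :
  contfun_norm (a *: f) = `|a| * contfun_norm f.
Proof.
have le (b : R) (g : CK) : contfun_norm (b *: g) <= `|b| * contfun_norm g.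
  apply: contfun_norm_le => [|x]; first by rewrite mulr_ge0// contfun_norm_ge0.
  by rewrite contfunZ normrM ler_wpM2l// contfun_norm_ge.
apply/eqP; rewrite eq_le le /=.
have [->|a0] := eqVneq a 0; first by rewrite normr0 mul0r contfun_norm_ge0.
have := le a^-1 (a *: f).
by rewrite scalerA mulVf// scale1r normfV ler_pdivlMl// normr_gt0.
Qed.

Lemma contfun_norm_eq0 (f : CK) : contfun_norm f = 0 -> f = 0.
Proof.
move=> f0; apply: contfunP => x; apply/eqP.
by rewrite contfun0 -normr_le0 -f0 contfun_norm_ge.
Qed.

HB.instance Definition _ := Lmodule_isNormed.Build R CK
  contfun_ler_normD contfun_normZ contfun_norm_eq0.

Lemma contfun_normE (f : CK) : `|f| = sup [set `|f x| | x in [set: K]].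
Proof. by []. Qed.

Lemma contfun_complete (F : set_system CK) :
  ProperFilter F -> cauchy F -> cvg F.
Proof.
move=> PF /cauchy_ballP Fc.
have {}Fc (e : R) : 0 < e ->
    exists2 f : CK, F [set g : CK | `|f - g| < e] &
      forall x, F [set g : CK | `|f x - g x| < e].
  move=> e0; have /cauchy_ballP/cauchyP/(_ e e0)[f Ff] := Fc.
  have {}Ff : F [set g : CK | `|f - g| < e] by exact: Ff.
  exists f => // x; apply: filterS Ff => g /=; apply: le_lt_trans.
  exact: contfun_norm_ge (f - g) x.
have cvgx x : cvg ((fun g : CK => g x) @ F).
  apply: R_complete; apply/cauchyP => e e0.
  by have [f _ fx] := Fc e e0; exists (f x); exact: fx.
pose l x := lim ((fun g : CK => g x) @ F).
have lF (e : R) : 0 < e ->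
    exists2 f : CK, F [set g : CK | `|f - g| < e] & forall x, `|f x - l x| <= e.
  move=> e0; have [f Ff fx] := Fc e e0; exists f => // x.
  rewrite ler_distlC; apply/andP; split.
    apply: limr_ge; first exact: cvgx.
    by apply: filterS (fx x) => g /= /ltW; rewrite ler_distlC => /andP[].
  apply: limr_le; first exact: cvgx.
  by apply: filterS (fx x) => g /= /ltW; rewrite ler_distlC => /andP[].
have cl : continuous l.
  move=> x; apply/cvgrPdist_le => e e0.
  have e3 : 0 < e / 3 by rewrite divr_gt0.
  have [f _ fl] := lF _ e3.
  have /cvgrPdist_le/(_ _ e3) := @contfun_continuous f x.
  apply: filterS => y fxy.
  have -> : l x - l y = (l x - f x) + (f x - f y) + (f y - l y).
    by ring.
  rewrite (le_trans (ler_normD _ _))// (splitr e).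
  have -> : e / 2 + e / 2 = (e / 3 + e / 3) + e / 3 by field.
  apply: lerD => //; rewrite (le_trans (ler_normD _ _))// lerD//.
  by rewrite distrC.
apply/cvg_ex; exists (Contfun cl : CK); apply/cvgrPdist_le => e e0.
have e2 : 0 < e / 2 by rewrite divr_gt0.
have [f Ff fl] := lF _ e2.
apply: filterS Ff => g /= /ltW fg.
have -> : (Contfun cl : CK) - g = ((Contfun cl : CK) - f) + (f - g).
  by rewrite addrA subrK.
rewrite (le_trans (ler_normD _ _))// (splitr e) lerD//.
by apply: contfun_norm_le => [|x]; [exact: ltW | rewrite distrC; exact: fl].
Qed.

HB.instance Definition _ := Uniform_isComplete.Build CK contfun_complete.

End contfun_lmodule.

Definition c0_copy (R : realType) (g : nat_compactification) :
    set (contfun R (compactification_compact g)) :=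
  [set f : contfun R (compactification_compact g) |
    forall x : g, remainder g x -> f x = 0].

(* A subset of a normed space is complemented when it is the range of a
   bounded linear projection. *)
Definition complemented (R : realType) (V : normedModType R) (Y : set V) :
    Prop :=
  exists P : {linear V -> V},
    [/\ exists M : R, forall v, `|P v| <= M * `|v|,
        idempotent_fun P & range P = Y].

Definition smooth (R : realType) (g : nat_compactification) : Prop :=
  complemented (@c0_copy R g).

(* Main.v *)
(* Let n stand for the residue class of n modulo j!, where j = level n is the
   largest j with j! <= n + 1, and let mean n be a finitely additive mean on
   bounded sequences concentrated on that class and vanishing on c_0.  The sets
   A for which mean n 1_A - 1_A(n) tends to 0 form a Boolean algebra containing
   the finite sets, hence yield a zero-dimensional compactification of nat, and
   f |-> (f n - mean n f)_n is a projection of its C(K) onto c_0.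

   Residue classes modulo i! belong to the algebra.  So do unions U of one tail
   of a residue class modulo i! for each i >= 3: if n is not in U then
   mean n 1_U is at most the sum of j!/i! over i > j = level n, which is at
   most 2/(j+1).  The complement of such a U is infinite.  Given points x_k of
   the remainder, x_k determines a residue class modulo (k+3)!, and the
   complement of the union U of these classes defines a nonempty open subset
   of the remainder which contains none of the x_k. *)
Require Import Defs.
From HB Require Import structures.
From mathcomp Require Import all_boot all_order all_algebra.
From mathcomp Require Import all_classical all_reals all_analysis.
From mathcomp Require Import ring lra zify.

Set Implicit Arguments.
Unset Strict Implicit.
Unset Printing Implicit Defensive.

Import Order.TTheory GRing.Theory Num.Theory.
Import numFieldNormedType.Exports.

Local Open Scope classical_set_scope.
Local Open Scope ring_scope.

(** * Isolated points and accumulation in the remainder *)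

Lemma nat_emb_open1 (g : nat_compactification) n : open [set nat_emb g n].
Proof.
have [inj cts emb] := nat_emb_embedding g.
have [U oU Un] := emb [set n] (discrete_open _).
have accg := hausdorff_accessible (@compactification_hausdorff g).
have oV : open (U `\ nat_emb g n).
  by apply: openI => //; apply: closed_openC; exact: accessible_closed_set1.
suff V0 : U `\ nat_emb g n = set0.
  rewrite (_ : [set _] = U) //; apply/seteqP; split=> x.
    by move=> ->; have : (nat_emb g @^-1` U) n by rewrite Un.
  by move=> Ux; apply: contrapT => nx; have : set0 x by rewrite -V0; split.
apply: contrapT => /eqP/set0P V0.
have [y [[Uy ny] [m _ my]]] := @nat_emb_dense g _ V0 oV.
have : [set n] m by rewrite -Un /preimage /= my.
by move=> mn; apply: ny; rewrite -my mn.
Qed.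

(** A cluster point of the filter generated by the images of the tails of [P] works: it is not an
    integer, since integers are isolated. *)
Lemma remainder_accumulation (g : nat_compactification) (P : set nat) :
  (forall N, exists2 n, (N <= n)%N & P n) ->
  exists2 x, remainder g x &
    forall W N, nbhs x W -> exists2 n, (N <= n)%N & P n /\ W (nat_emb g n).
Proof.
move=> Pinf.
pose F := [set S : set g | exists N, forall n, (N <= n)%N -> P n -> S (nat_emb g n)].
have FF : ProperFilter F.
  split; last first.
    split; first by exists 0%N.
      move=> A B [N HA] [M HB]; exists (maxn N M) => n.
      by rewrite geq_max => /andP[Nn Mn] Pn; split; [exact: HA|exact: HB].
    by move=> A B AB [N HA]; exists N => n Nn Pn; apply: AB; exact: HA.
  by case=> N HN; have [n Nn Pn] := Pinf N; exact: HN Nn Pn.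
have [x [_ clx]] : [set: g] `&` cluster F !=set0.
  by apply: compactification_compact => //; exists 0%N.
have clP W N : nbhs x W -> exists2 n, (N <= n)%N & P n /\ W (nat_emb g n).
  move=> Wx; have FN : F [set y | exists2 n, (N <= n)%N & P n /\ y = nat_emb g n].
    by exists N => n Nn Pn; exists n.
  by have [y [[n Nn [Pn ->]] Wn]] := clx _ _ FN Wx; exists n.
exists x => //; case=> n _ nx.
have [inj _ _] := nat_emb_embedding g.
have [|m nm [_ /inj mn]] := clP [set nat_emb g n] n.+1.
  by rewrite -nx; apply: open_nbhs_nbhs; split => //; exact: nat_emb_open1.
by rewrite mn ltnn in nm.
Qed.

(** Otherwise the indices where [f] has size at least [e] accumulate at a remainder point, where [f]
    vanishes. *)
Lemma c0_copy_cvg0 (R : realType) (g : nat_compactification)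
    (f : contfun R (compactification_compact g)) :
  c0_copy f -> f (nat_emb g n) @[n --> \oo] --> 0.
Proof.
move=> f0; apply/cvgr0Pnorm_lt => e e0; apply: contrapT => nf.
have [|x rx Px] := @remainder_accumulation g [set n | e <= `|f (nat_emb g n)|].
  move=> N; apply: contrapT => nP; apply: nf; exists N => // n /= Nn.
  by rewrite ltNge; apply/negP => en; apply: nP; exists n.
have /cvgrPdist_lt/(_ _ e0) := @contfun_continuous _ _ _ f x.
rewrite (f0 x rx) => /(Px _ 0%N)[n _ /= [en]].
by rewrite sub0r normrN ltNge en.
Qed.

(** * Smoothness from functionals asymptotic to evaluation *)

Section smooth_criterion.
Variables (R : realType) (g : nat_compactification).
Variable nu : nat -> (nat -> R) -> R.
Hypothesis nu_linear : forall n (a : R) (u v : nat -> R) (M : R),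
  (forall k, `|u k| <= M) -> (forall k, `|v k| <= M) ->
  nu n (fun k => a * u k + v k) = a * nu n u + nu n v.
Hypothesis nu_bounded : forall n (u : nat -> R) (M : R),
  (forall k, `|u k| <= M) -> `|nu n u| <= M.
Hypothesis nu_c0 : forall n (u : nat -> R), u @ \oo --> 0 -> nu n u = 0.

Local Notation CK := (contfun R (compactification_compact g)).
Local Notation emb := (nat_emb g).

Hypothesis nu_asymptotic : forall f : CK,
  f (emb n) - nu n (f \o emb) @[n --> \oo] --> 0.

(* The projection onto the natural copy of c_0. *)
Definition defect (f : CK) (x : g) : R :=
  match pselect (exists n, emb n = x) with
  | left Ex => let n := projT1 (cid Ex) in f (emb n) - nu n (f \o emb)
  | right _ => 0
  end.

Lemma defect_emb f n : defect f (emb n) = f (emb n) - nu n (f \o emb).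
Proof.
rewrite /defect; case: pselect => [Ex|[]]; last by exists n.
case: (cid Ex) => m /=; have [inj _ _] := nat_emb_embedding g.
by move=> /inj ->.
Qed.

Lemma defect_remainder f x : remainder g x -> defect f x = 0.
Proof.
by move=> rx; rewrite /defect; case: pselect => // -[n nx]; case: rx; exists n.
Qed.

Lemma defect_continuous f : continuous (defect f).
Proof.
move=> x; have [[n _ <-]|rx] := pselect (range emb x).
  apply/cvgrPdist_le => e e0.
  have := open_nbhs_nbhs (conj (nat_emb_open1 g n) (erefl (emb n))).
  by apply: filterS => _ ->; rewrite subrr normr0 ltW.
rewrite /continuous_at (defect_remainder _ rx); apply/cvgr0Pnorm_le => e e0.
have /cvgr0Pnorm_le/(_ _ e0)[N _ HN] := nu_asymptotic f.
have accg := hausdorff_accessible (@compactification_hausdorff g).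
have cl : closed [set emb n | n in `I_N].
  have /accessible_finite_set_closed := accg.
  by apply; exact/finite_image/finite_II.
(* A neighbourhood of a remainder point can avoid the integers below [N], so only the tail estimate
   on the defect matters. *)
have : nbhs x (~` [set emb n | n in `I_N]).
  apply: open_nbhs_nbhs; split; first exact: closed_openC.
  by case=> n _ nx; apply: rx; exists n.
apply: filterS => y Ny; have [[n _ ny]|ry] := pselect (range emb y).
  rewrite -ny defect_emb; apply: HN => /=; rewrite leqNgt; apply/negP => nN.
  by apply: Ny; exists n.
by rewrite defect_remainder ?normr0 ?ltW.
Qed.

Definition defect_fun (f : CK) : CK := Contfun (@defect_continuous f).

Lemma defect_funE f x : defect_fun f x = defect f x. Proof. by []. Qed.

Lemma defect_fun_linear : linear defect_fun.
Proof.
move=> a f h; apply: contfunP => x.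
rewrite contfunD contfunZ !defect_funE.
have [[n _ <-]|rx] := pselect (range emb x); last first.
  by rewrite !defect_remainder// mulr0 addr0.
rewrite !defect_emb contfunD contfunZ.
rewrite -[nu n ((a *: f + h) \o emb)]/(nu n (fun k => a * (f \o emb) k + (h \o emb) k)).
rewrite (@nu_linear n a _ _ (contfun_norm f + contfun_norm h)); first by ring.
- move=> k; rewrite (le_trans (contfun_norm_ge f _))// lerDl.
  exact: contfun_norm_ge0.
- move=> k; rewrite (le_trans (contfun_norm_ge h _))// lerDr.
  exact: contfun_norm_ge0.
Qed.

Lemma defect_fun_c0 f : c0_copy (defect_fun f).
Proof. by move=> x rx; exact: defect_remainder. Qed.

Lemma defect_fun_id f : c0_copy f -> defect_fun f = f.
Proof.
move=> f0; apply: contfunP => x; rewrite defect_funE.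
have [[n _ <-]|rx] := pselect (range emb x).
  by rewrite defect_emb nu_c0 ?subr0//; exact: c0_copy_cvg0.
by rewrite defect_remainder// f0.
Qed.

Lemma smooth_of_asymptotic : smooth R g.
Proof.
pose P : {linear CK -> CK} :=
  HB.pack defect_fun (GRing.isLinear.Build R CK CK *:%R defect_fun defect_fun_linear).
exists P; split.
- exists 2 => f; apply: contfun_norm_le.
    by rewrite mulr_ge0//; exact: normr_ge0.
  move=> x; rewrite defect_funE; have [[n _ <-]|rx] := pselect (range emb x); last first.
    by rewrite defect_remainder// normr0 mulr_ge0//; exact: normr_ge0.
  rewrite defect_emb (le_trans (ler_normB _ _))// mulr_natl mulr2n lerD//.
    exact: contfun_norm_ge.
  by apply: nu_bounded => k; exact: contfun_norm_ge.
- by move=> f; exact/defect_fun_id/defect_fun_c0.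
- apply/seteqP; split=> [_ [f _ <-]|f f0]; first exact: defect_fun_c0.
  by exists f => //; exact: defect_fun_id.
Qed.

End smooth_criterion.

(** * Factorial levels and counting in residue classes *)

(** The range [i < n.+2] misses no candidate, because i <= i!. *)
Definition level (n : nat) : nat := \max_(i < n.+2 | (i`! <= n.+1)%N) i.

(* [n.+1] rather than [n], so that this also holds for [n = 0]. *)
Lemma leq_level i n : (i <= level n)%N = (i`! <= n.+1)%N.
Proof.
apply/idP/idP => [|iln].
  rewrite /level (@bigop.bigmax_eq_arg _ ord0)//; case: arg_maxnP => //= j jn _ ij.
  exact: leq_trans (leq_fact ij) jn.
have iln2 : (i < n.+2)%N by rewrite ltnS (leq_trans (fact_geq i)).
exact: (@leq_bigmax_cond _ _ (@nat_of_ord n.+2) (Ordinal iln2)).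
Qed.

Lemma count_residue q d a : (0 < d)%N ->
  (\sum_(0 <= m < q * d | m == a %[mod d]) 1 = q)%N.
Proof.
move=> d0; elim: q => [|q IHq]; first by rewrite mul0n big_geq.
rewrite mulSn addnC (@big_cat_nat _ _ _ (q * d))//= ?leq_addr// IHq.
rewrite -{1}[(q * d)%N]add0n big_addn addnC addKn -[in RHS]add1n.
congr (_ + _)%N.
rewrite big_mkord (eq_bigl (pred1 (Ordinal (ltn_pmod a d0)))) ?big_pred1_eq//.
by move=> i; rewrite addnC modnMDl (modn_small (ltn_ord i)) /= -val_eqE.
Qed.

Lemma fact_divnK i l : (i <= l)%N -> (l`! = l`! %/ i`! * i`!)%N.
Proof.
by move=> il; rewrite divnK// (fact_split il) dvdn_mulr.
Qed.

(** * Averages over residue classes *)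

Section average.
Variable R : realType.

(* The mean of [u] over the residue class of [n] modulo [j`!] in [0, l`!); this
   normalization is only right for [j <= l]. *)
Definition average (j n : nat) (u : nat -> R) (l : nat) : R :=
  j`!%:R / l`!%:R * \sum_(0 <= m < l`! | m == n %[mod j`!]) u m.

Lemma average_linear j n a u v l :
  average j n (fun k => a * u k + v k) l = a * average j n u l + average j n v l.
Proof. by rewrite /average big_split/= -mulr_sumr mulrDr mulrCA. Qed.

Lemma ler_average j n u v l : (forall m, m = n %[mod j`!] -> u m <= v m) ->
  average j n u l <= average j n v l.
Proof.
move=> uv; rewrite ler_wpM2l ?divr_ge0 ?ler0n//.
by apply: ler_sum => m /eqP; exact: uv.
Qed.

Lemma average_cst j n c l : (j <= l)%N -> average j n (fun=> c) l = c.
Proof.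
move=> jl; rewrite /average (eq_bigr (fun=> c * 1%:R)) => [|m _]; last by rewrite mulr1.
rewrite -mulr_sumr -natr_sum {2}(fact_divnK jl) count_residue ?fact_gt0//.
have j0 : j`!%:R != 0 :> R by rewrite pnatr_eq0 -lt0n fact_gt0.
have q0 : (l`! %/ j`!)%:R != 0 :> R.
  by rewrite pnatr_eq0 -lt0n divn_gt0 ?fact_gt0// leq_fact.
by rewrite {1}(fact_divnK jl) natrM; field; rewrite j0 q0.
Qed.

Lemma average_initial j n N l :
  average j n \1_(`I_N) l <= j`!%:R * N%:R / l`!%:R.
Proof.
have cnt L : (\sum_(0 <= m < L) (m < N) = minn L N)%N.
  elim: L => [|L IH]; first by rewrite big_geq ?min0n.
  by rewrite big_nat_recr//= IH; lia.
rewrite /average mulrAC ler_wpM2r ?invr_ge0 ?ler0n// ler_wpM2l ?ler0n//.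
rewrite (@le_trans _ _ (\sum_(0 <= m < l`!) (m < N)%N%:R))//; last first.
  by rewrite -natr_sum cnt ler_nat geq_minr.
rewrite big_mkcond; apply: ler_sum => m _; case: ifP => _; last exact: ler0n.
by rewrite indicE (_ : (m \in `I_N) = (m < N)%N)//; apply/idP/idP; rewrite inE.
Qed.

End average.

(** * Limits along a free ultrafilter *)

(** A cluster point of an ultrafilter is its limit: if the preimage of a neighbourhood were missing,
    its complement would belong to [U] and contradict clustering. *)
Lemma ultra_cvg_compact (X : Type) (T : topologicalType) (U : set_system X)
    (A : set T) (f : X -> T) : UltraFilter U -> compact A ->
  (\forall x \near U, A (f x)) -> exists p : T, f @ U --> p.
Proof.
move=> UU cA UA; have [p [_ clp]] := cA (f @ U) _ UA.
exists p => W Wp; have [//|UW] := in_ultra_setVsetC (f @^-1` W) UU.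
by have [y [nWy Wy]] := clp (~` W) W UW Wp.
Qed.

Definition free_ultrafilter : set_system nat :=
  projT1 (cid (ultraFilterLemma eventually_filter)).

#[local] Instance free_ultrafilter_ultra : UltraFilter free_ultrafilter.
Proof. by rewrite /free_ultrafilter; case: cid => U []. Qed.

Lemma free_ultrafilter_eventually : free_ultrafilter --> \oo.
Proof. by rewrite /free_ultrafilter; case: cid => U []. Qed.

(** * Finitely additive means on residue classes *)

Section means.
Variable R : realType.
Implicit Types (u v : nat -> R) (A B : set nat).

(* Junk for unbounded [u], where the limit may fail to exist. *)
Definition mean (n : nat) u : R :=
  lim (average (level n) n u @ free_ultrafilter).

Lemma mean_cvg n u (M : R) : (forall k, `|u k| <= M) ->
  average (level n) n u @ free_ultrafilter --> mean n u.
Proof.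
move=> uM; apply: (@cvgP _ _ _).
have [] := @ultra_cvg_compact _ R _ `[- M, M] (average (level n) n u)
  free_ultrafilter_ultra (@segment_compact R _ _).
  (* From [level n] on, averaging fixes constants, so the averages stay in the compact interval. *)
  apply: free_ultrafilter_eventually; exists (level n) => // l /= nl.
  have {}uM k : - M <= u k <= M by rewrite -ler_norml.
  rewrite /= in_itv/=; apply/andP; split.
    rewrite -[leLHS](average_cst n (- M) nl).
    by apply: ler_average => m _; have /andP[] := uM m.
  rewrite -[leRHS](average_cst n M nl).
  by apply: ler_average => m _; have /andP[] := uM m.
by move=> p up; apply/cvg_ex; exists p.
Qed.

Lemma mean_linear n a u v (M : R) :
  (forall k, `|u k| <= M) -> (forall k, `|v k| <= M) ->
  mean n (fun k => a * u k + v k) = a * mean n u + mean n v.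
Proof.
move=> uM vM; apply/cvg_lim => //.
under eq_cvg do rewrite average_linear.
by apply: cvgD; [apply: cvgMr; exact: mean_cvg uM|exact: mean_cvg vM].
Qed.

Lemma mean_le n u (M c : R) : (forall k, `|u k| <= M) ->
  (forall e, 0 < e -> \forall l \near \oo, average (level n) n u l <= c + e) ->
  mean n u <= c.
Proof.
move=> uM uc; apply/ler_addgt0Pr => e e0; apply: limr_le.
  by apply/cvg_ex; exists (mean n u); exact: mean_cvg uM.
exact: free_ultrafilter_eventually (uc _ e0).
Qed.

Lemma mean_le_eventually n u (M c : R) N : (forall k, `|u k| <= M) ->
  (forall m, (N <= m)%N -> m = n %[mod (level n)`!] -> u m <= c) ->
  mean n u <= c.
Proof.
move=> uM uc; apply: (mean_le uM) => e e0.
pose K := M + `|c|; pose J := (level n)`!%:R * N%:R : R.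
have K0 : 0 <= K by rewrite addr_ge0// (le_trans _ (uM 0%N)).
(* Since l <= l!, such an [l] makes K * J / l! at most [e]. *)
exists (maxn (level n) (Num.truncn (K * J / e)).+1) => // l /=.
rewrite geq_max => /andP[nl Kl].
have ul m : m = n %[mod (level n)`!] -> u m <= K * \1_(`I_N) m + c.
  move=> mn; rewrite indicE; have [mN|Nm] := ltnP m N.
    rewrite mem_set//= mulr1 /K.
    have := le_trans (ler_norm _) (uM m); have := ler_norm (- c).
    by rewrite normrN; lra.
  rewrite memNset ?mulr0 ?add0r; last by rewrite /= ltnNge Nm.
  exact: uc.
rewrite (le_trans (ler_average l ul))// average_linear average_cst//.
rewrite addrC lerD2l (le_trans (ler_wpM2l K0 (average_initial _ _ _ _ _)))//.
rewrite -/J mulrA ler_pdivrMr ?ltr0n ?fact_gt0// [leRHS]mulrC -ler_pdivrMr//.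
rewrite (le_trans (ltW (truncnS_gt _)))// ler_nat.
exact: leq_trans Kl (fact_geq _).
Qed.

Lemma mean_opp n u (M : R) : (forall k, `|u k| <= M) ->
  mean n (fun k => - u k) = - mean n u.
Proof.
(* The coefficient -2 gives the opposite the shape [a * u + v] with [v = u]. *)
move=> uM; rewrite (_ : (fun k => - u k) = (fun k => (-2) * u k + u k)); last first.
  by apply/funext => k; ring.
by rewrite (mean_linear n _ uM uM); ring.
Qed.

Lemma mean_bounded n u (M : R) : (forall k, `|u k| <= M) -> `|mean n u| <= M.
Proof.
move=> uM; rewrite ler_norml lerNl -(mean_opp n uM).
apply/andP; split; apply: (@mean_le_eventually _ _ M _ 0%N) => // m.
- by rewrite normrN.
- by move=> _ _; rewrite (le_trans (ler_norm _))// normrN.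
- by move=> _ _; rewrite (le_trans (ler_norm _)).
Qed.

Lemma mean_c0 n u : u @ \oo --> 0 -> mean n u = 0.
Proof.
move=> u0; have [M uM] : exists M, forall k, `|u k| <= M.
  have [M [_ HM]] := cvg_seq_bounded (cvgP _ u0).
  by exists (M + 1) => k; apply: HM; rewrite ?ltrDl.
apply/eqP; rewrite -normr_le0; apply/ler_addgt0Pr => e e0; rewrite add0r.
move/cvgr0Pnorm_le : u0 => /(_ _ e0)[N _ uN].
rewrite ler_norml lerNl -(mean_opp n uM).
apply/andP; split; apply: (@mean_le_eventually _ _ M _ N) => // m.
- by rewrite normrN.
- by move=> Nm _; rewrite (le_trans (ler_norm _))// normrN; exact: uN.
- by move=> Nm _; rewrite (le_trans (ler_norm _))//; exact: uN.
Qed.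

Lemma mean_cst n c : mean n (fun=> c) = c.
Proof.
have le b : mean n (fun=> b) <= b.
  by apply: (@mean_le_eventually _ _ `|b| _ 0%N) => *; exact: lexx.
by apply/eqP; rewrite eq_le le/= -lerN2 -(@mean_opp n _ `|c|)//.
Qed.

Lemma mean_mono n u v (M : R) : (forall k, `|u k| <= M) -> (forall k, `|v k| <= M) ->
  (forall k, u k <= v k) -> mean n u <= mean n v.
Proof.
move=> uM vM uv; rewrite -subr_le0 -mulN1r addrC -(mean_linear n _ vM uM).
apply: (@mean_le_eventually _ _ (M + M) _ 0%N) => k.
  by rewrite mulN1r (le_trans (ler_normD _ _))// normrN lerD.
by have := uv k; lra.
Qed.

Lemma indic_bounded A k : `|(\1_A k : R)| <= 1.
Proof. by rewrite indicE; case: (_ \in _); rewrite ?normr1 ?normr0. Qed.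

Lemma mean_setC n A : mean n \1_A = 1 - mean n \1_(~` A).
Proof.
rewrite -[in RHS](mean_cst n 1).
rewrite [X in mean n X - _](_ : _ = fun k => 1 * \1_A k + \1_(~` A) k).
  by rewrite (mean_linear n _ (indic_bounded A) (indic_bounded (~` A))); ring.
by apply/funext => k; rewrite !indicE in_setC; case: (_ \in _) => /=; ring.
Qed.

Lemma mean_indic_eq0 n A N :
  (forall m, (N <= m)%N -> m = n %[mod (level n)`!] -> ~ A m) -> mean n \1_A <= 0.
Proof.
move=> nA; apply: (mean_le_eventually (N := N) (indic_bounded A)) => m Nm mn.
by rewrite indicE memNset//; exact: nA.
Qed.

Lemma mean_le_on n A u (M c : R) : (forall k, `|u k| <= M) ->
  (forall k, A k -> u k <= c) ->
  mean n u <= (M + `|c|) * mean n \1_(~` A) + c.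
Proof.
move=> uM uc; have uM' k := le_trans (ler_norm _) (uM k).
have K0 : 0 <= M + `|c| by rewrite addr_ge0// (le_trans _ (uM 0%N)).
have cM k : `|c| <= M + `|c| by rewrite lerDr (le_trans _ (uM 0%N)).
have -> : (M + `|c|) * mean n \1_(~` A) + c =
    mean n (fun k => (M + `|c|) * \1_(~` A) k + c).
  rewrite (@mean_linear _ _ _ _ (1 + `|c|)) ?mean_cst// => k.
    by rewrite (le_trans (indic_bounded _ _))// lerDl.
  by rewrite lerDr.
apply: (@mean_mono _ _ _ (M + `|c| + `|c|)) => k.
- by rewrite (le_trans (uM k))// -addrA lerDl addr_ge0.
- rewrite (le_trans (ler_normD _ _))// lerD2r normrM ger0_norm//.
  by rewrite ler_piMr// indic_bounded.
- rewrite indicE in_setC; have [/set_mem/uc|_] := boolP (k \in A).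
    by rewrite mulr0 add0r.
  by rewrite mulr1; have := uM' k; have := ler_norm (- c); rewrite normrN; lra.
Qed.

(** * The Boolean algebra of determined sets *)

(** By [mean_setC] this says that [mean n \1_A - \1_A n] tends to 0; stated as two upper bounds,
    which complementation exchanges. *)
Definition determined A := forall e : R, 0 < e ->
  \forall n \near \oo, (A n -> mean n \1_(~` A) <= e) /\ (~ A n -> mean n \1_A <= e).

Lemma determinedC A : determined A -> determined (~` A).
Proof.
move=> dA e e0; apply: filterS (dA e e0) => n [An nAn].
by rewrite setCK; split=> // /contrapT.
Qed.

Lemma determinedI A B : determined A -> determined B -> determined (A `&` B).
Proof.
move=> dA dB e e0; have e2 : 0 < e / 2 by rewrite divr_gt0.
apply: filterS2 (dA _ e2) (dB _ e2) => n [An nAn] [Bn nBn].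
have mono C D : C `<=` D -> mean n \1_C <= mean n \1_D.
  move=> CD; apply: (mean_mono n (indic_bounded C) (indic_bounded D)) => k.
  rewrite !indicE ler_nat; have [/set_mem/CD|//] := boolP (k \in C).
  by move/mem_set => ->.
split=> [[/An mA /Bn mB]|/not_andP[/nAn|/nBn]]; last 2 first.
- by move/(le_trans (mono _ _ (@subIsetl _ A B))); lra.
- by move/(le_trans (mono _ _ (@subIsetr _ A B))); lra.
rewrite (@le_trans _ _ (mean n (fun k => 1 * \1_(~` A) k + \1_(~` B) k)))//; last first.
  by rewrite (mean_linear n _ (indic_bounded _) (indic_bounded _)); lra.
apply: (@mean_mono _ _ _ 2) => k.
- by rewrite (le_trans (indic_bounded _ _))// ler1n.
- rewrite (le_trans (ler_normD _ _))// mul1r.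
  by rewrite (_ : 2 = 1 + 1 :> R)// lerD// indic_bounded.
- rewrite mul1r setCI !indicE -natrD ler_nat.
  have [/set_mem[]/mem_set ->|//] := boolP (k \in ~` A `|` ~` B).
    by rewrite leq_addr.
  by rewrite leq_addl.
Qed.

Lemma determinedT : determined setT.
Proof.
move=> e e0; exists 0%N => // n _; split=> [_|[]//]; apply: le_trans (ltW e0).
by apply: (@mean_indic_eq0 _ _ 0%N) => m _ _; apply.
Qed.

Lemma determined_set1 m : determined [set m].
Proof.
move=> e e0; exists m.+1 => // n /= mn; split=> [nm|_]; first by rewrite nm ltnn in mn.
apply: le_trans (ltW e0); apply: (@mean_indic_eq0 _ _ m.+1) => k mk _ /= km.
by rewrite km ltnn in mk.
Qed.

(** Once [i <= level n], the class of [n] modulo (level n)! lies inside one class modulo i!, so it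
    is contained in the set or disjoint from it. *)
Lemma determined_residue i a : determined [set m | m = a %[mod i`!]].
Proof.
move=> e e0; exists i`! => // n /= i_n.
have res m : m = n %[mod (level n)`!] -> m = n %[mod i`!].
  have il : (i <= level n)%N by rewrite leq_level ltnW.
  move=> mn; have d : (i`! %| (level n)`!)%N by rewrite (fact_split il) dvdn_mulr.
  by rewrite -(modn_dvdm m d) mn modn_dvdm.
split=> na; apply: le_trans (ltW e0); apply: (@mean_indic_eq0 _ _ 0%N) => k _ /res kn /=.
  by apply; rewrite kn.
by move=> ka; apply: na; rewrite -kn.
Qed.

End means.

(** * Sparse unions of residue classes *)

(* [2 < i] makes the densities [1 / i`!] sum up to less than 1, and
   [i`! <= m.+1] is [i <= level m]. *)
Definition sparse_union (a : nat -> nat) : set nat :=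
  [set m | exists i, [/\ (2 < i)%N, (i`! <= m.+1)%N & m = a i %[mod i`!]]].

Section sparse.
Variables (R : realType) (a : nat -> nat).

(** The subtracted term makes the induction close, by 2/(l+1)! <= 1/l!. *)
Lemma sum_inv_fact_le j l : (j < l)%N ->
  \sum_(j.+1 <= i < l) (i`!%:R)^-1 <= 2 / (j.+1)`!%:R - 2 / l`!%:R :> R.
Proof.
elim: l => [//|l IH]; rewrite ltnS leq_eqVlt => /predU1P[->|jl].
  by rewrite big_geq// subrr.
rewrite big_nat_recr//= (le_trans (lerD (IH jl) (lexx _)))//.
have l0 : 0 < (l`!%:R : R)^-1 by rewrite invr_gt0 ltr0n fact_gt0.
have ll : (l.+1)%:R^-1 <= 2^-1 :> R.
  by rewrite lef_pV2 ?posrE// ler_nat ltnS (leq_trans _ jl).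
rewrite (factS l) natrM invfM; move: l0 ll; set x := l`!%:R^-1; set y := l.+1%:R^-1.
move=> l0 ll; have : y * x <= 2^-1 * x by rewrite ler_pM2r.
by lra.
Qed.

(** Only classes with j < i <= l meet the class of [n] modulo j! below l!. The i-th has l!/i!
    elements there, hence weight at most j!/i!, and these weights sum to at most 2/(j+1). *)
Lemma mean_sparse_union n : ~ sparse_union a n ->
  mean n \1_(sparse_union a) <= 2 / (level n).+1%:R :> R.
Proof.
set j := level n => nU.
apply: (mean_le (indic_bounded R _)) => e e0; exists j.+1 => // l /= jl.
apply: (@le_trans _ _ (2 / j.+1%:R)); last by rewrite lerDl ltW.
rewrite /average -/j.
have Ule m : (m < l`!)%N -> m = n %[mod j`!] -> (\1_(sparse_union a) m : R) <=
    \sum_(j.+1 <= i < l.+1) (m == a i %[mod i`!])%:R.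
  move=> ml mn; rewrite indicE; have [/set_mem[i [i3 im mi]]|_] := boolP (m \in _);
    last first.
    by apply: sumr_ge0.
  have il : (i < l.+1)%N.
    rewrite ltnS leqNgt; apply/negP => li.
    have := leq_trans im ml; rewrite leqNgt => /negP; apply.
    by apply: ltn_fact => //; exact: leq_trans jl.
  (* If [i <= j], then [n] is congruent to [m] modulo i! and is large enough, so [n] itself would
     lie in the union. *)
  have ji : (j < i)%N.
    rewrite ltnNge; apply/negP => ij; apply: nU; exists i; split => //.
      by rewrite -leq_level.
    have d : (i`! %| j`!)%N by rewrite (fact_split ij) dvdn_mulr.
    by rewrite -(modn_dvdm n d) -mn modn_dvdm.
  rewrite (big_cat_nat (n := i))//=; last exact: ltnW.
  rewrite [X in _ + X]big_ltn// mi eqxx.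
  by rewrite addrCA lerDl addr_ge0// sumr_ge0.
have sumU : \sum_(0 <= m < l`! | m == n %[mod j`!]) \1_(sparse_union a) m <=
    \sum_(j.+1 <= i < l.+1) (l`! %/ i`!)%:R :> R.
  rewrite big_nat_cond (@le_trans _ _ (\sum_(0 <= m < l`!) \sum_(j.+1 <= i < l.+1)
    (m == a i %[mod i`!])%:R))//.
    rewrite [leRHS]big_nat_cond big_mkcond [leRHS]big_mkcond.
    apply: ler_sum => m _; rewrite andbT; case: ifP => [/andP[ml /eqP mn]|_].
      by rewrite ml; apply: Ule => //; case/andP: ml.
    by case: ifP => // _; apply: sumr_ge0.
  rewrite exchange_big/= big_nat [leRHS]big_nat; apply: ler_sum => i /andP[_ il].
  rewrite -natr_sum ler_nat (fact_divnK (i := i))// mulnK ?fact_gt0//.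
  by rewrite -[leqRHS](@count_residue _ i`! (a i)) ?fact_gt0// [leqRHS]big_mkcond.
rewrite (le_trans (ler_wpM2l _ sumU)) ?divr_ge0//.
rewrite mulr_sumr (@le_trans _ _ (j`!%:R * \sum_(j.+1 <= i < l.+1) (i`!%:R)^-1))//.
  rewrite mulr_sumr big_nat [leRHS]big_nat ler_sum// => i /andP[_ il].
  have i0 : i`!%:R != 0 :> R by rewrite pnatr_eq0 -lt0n fact_gt0.
  have q0 : (l`! %/ i`!)%:R != 0 :> R.
    by rewrite pnatr_eq0 -lt0n divn_gt0 ?fact_gt0// leq_fact.
  rewrite le_eqVlt; apply/orP; left; apply/eqP.
  by rewrite {1}(@fact_divnK i l)// natrM; field; rewrite i0 q0.
rewrite (le_trans (ler_wpM2l _ (sum_inv_fact_le (leqW jl))))//.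
have j0 : j`!%:R != 0 :> R by rewrite pnatr_eq0 -lt0n fact_gt0.
have -> : 2 / j.+1%:R = j`!%:R * (2 / (j.+1)`!%:R) :> R.
  by rewrite (factS j) natrM invfM [RHS]mulrC -!mulrA mulVf// mulr1.
rewrite mulrBr.
by rewrite gerBl mulr_ge0// divr_ge0.
Qed.

(** If [n] enters the union through [i], the tail of its class modulo (level n)! does too; otherwise
    [mean_sparse_union] applies. *)
Lemma determined_sparse_union : determined R (sparse_union a).
Proof.
move=> e e0; exists (Num.truncn (2 / e)).+1`! => // n /= en; split=> Un.
  apply: le_trans (ltW e0); have [i [i3 im ni]] := Un.
  apply: (@mean_indic_eq0 _ _ _ i`!) => m mi mn; apply; exists i; split => //.
    exact: leqW.
  have il : (i <= level n)%N by rewrite leq_level.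
  have d : (i`! %| (level n)`!)%N by rewrite (fact_split il) dvdn_mulr.
  by rewrite -(modn_dvdm m d) mn modn_dvdm.
rewrite (le_trans (mean_sparse_union Un))// ler_pdivrMr// mulrC -ler_pdivrMr//.
rewrite (le_trans (ltW (truncnS_gt _)))// ler_nat.
by rewrite leqW// leq_level leqW.
Qed.

(** The point 1 is outside the union and has level 2, so its mean of the union is at most 2/3; a
    finite complement would force it to be 1. *)
Lemma sparse_unionC_infinite N : exists2 n, (N <= n)%N & ~ sparse_union a n.
Proof.
apply: contrapT => nN.
have lev1 : level 1 = 2%N by apply/eqP; rewrite eqn_leq leq_level andbT leqNgt leq_level.
have U1 : ~ sparse_union a 1.
  move=> [i [i3 i2 _]]; have := leq_trans (leq_fact i3) i2; by [].
have := mean_sparse_union U1; rewrite lev1 mean_setC.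
suff : mean 1 \1_(~` sparse_union a) <= 0 :> R by lra.
apply: (@mean_indic_eq0 _ _ _ N) => m Nm _ nU; apply: nN; by exists m.
Qed.

End sparse.

(** * Compactness and separation of subspaces *)

Lemma compact_set_type (T : topologicalType) (A : set T) :
  compact A -> compact [set: A].
Proof.
move=> cA F FF _.
have FA : (set_val @ F) A.
  by apply: (@filterS _ F _ setT) filterT => x _; exact: set_valP.
have [p [Ap clp]] := cA (set_val @ F) _ FA.
exists (exist _ p (mem_set Ap)); split => // S W FS [_ [[V oV <-] Vp VW]].
have FS' : (set_val @ F) (set_val @` S) by apply: (@filterS _ F _ S) FS => x Sx; exists x.
have [_ [[x Sx <-] Vx]] := clp _ V FS' (open_nbhs_nbhs (conj oV Vp)).
by exists x; split => //; exact: VW.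
Qed.

Lemma hausdorff_set_type (T : topologicalType) (A : set T) :
  hausdorff_space T -> hausdorff_space A.
Proof.
move=> hT p q clpq; apply: val_inj; apply: hT => V W pV qW.
have [x [Vx Wx]] := clpq _ _ (@initial_continuous _ _ set_val p _ pV)
  (@initial_continuous _ _ set_val q _ qW).
by exists (set_val x).
Qed.

(** * The compactification attached to the determined sets *)

Section compactification.
Variable R : realType.

Local Notation cube := (prod_topology (fun _ : set nat => bool)).

(* Coordinates outside the Boolean algebra are constantly false, which avoids
   indexing the cube by a subtype. *)
Definition code (n : nat) : cube := fun A => `[< determined R A /\ A n >].

(** This is the Stone space of the algebra of determined sets. *)
Definition growth : set cube := closure (range code).

Lemma codeE n A : determined R A -> code n A = `[< A n >].
Proof. by move=> dA; apply/asboolP/asboolP => [[]|]. Qed.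

Lemma nbhs_coordinate (y : cube) A : nbhs y [set z : cube | z A = y A].
Proof.
exact: (@proj_continuous _ (fun _ : set nat => bool) A y _ (discrete_set1 (y A))).
Qed.

(** Transfers any relation between finitely many coordinates from codes of integers to all points of
    the closure. *)
Lemma growth_code (y : cube) (s : seq (set nat)) : growth y ->
  exists n, forall A, A \in s -> y A = code n A.
Proof.
move=> Ky; have : nbhs y [set z : cube | forall A, A \in s -> z A = y A].
  elim: s => [|B s IH]; first by apply: (@filterS _ (nbhs y) _ setT) filterT.
  apply: filterS2 IH (nbhs_coordinate y B) => z zs zB A.
  by rewrite inE => /predU1P[->|/zs].
by move=> /Ky[_ [[n _ <-] H]]; exists n => A As; rewrite H.
Qed.

Lemma growth_code3 (y : cube) A B C : growth y ->
  exists n, [/\ y A = code n A, y B = code n B & y C = code n C].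
Proof.
move=> /(@growth_code _ [:: A; B; C])[n H].
by exists n; split; apply: H; rewrite !inE eqxx ?orbT.
Qed.

Lemma growth_determined (y : cube) A : growth y -> y A -> determined R A.
Proof. by move=> /(@growth_code3 _ A A A)[n [-> _ _]] /asboolP[]. Qed.

Lemma growthT (y : cube) : growth y -> y setT.
Proof.
move=> /(@growth_code3 _ setT setT setT)[n [-> _ _]].
by rewrite codeE; [exact/asboolP|exact: determinedT].
Qed.

Lemma growthC (y : cube) A : growth y -> determined R A -> y (~` A) = ~~ y A.
Proof.
move=> /(@growth_code3 _ A (~` A) A)[n [-> -> _]] dA.
by rewrite !codeE ?asbool_neg//; exact: determinedC.
Qed.

Lemma growthI (y : cube) A B : growth y -> determined R A -> determined R B ->
  y (A `&` B) = y A && y B.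
Proof.
move=> /(@growth_code3 _ A B (A `&` B))[n [-> -> ->]] dA dB.
by rewrite !codeE ?asbool_and//; exact: determinedI.
Qed.

Lemma growth_set1 (y : cube) n : growth y -> y [set n] -> y = code n.
Proof.
move=> gy yn; apply/funext => A.
have [m [-> yE _]] := growth_code3 A [set n] A gy.
by move: yn; rewrite yE => /asboolP[_ <-].
Qed.

Definition emb (n : nat) : growth :=
  exist _ (code n) (mem_set (subset_closure (ex_intro2 _ _ n I erefl))).

Lemma nbhs_growth_coordinate (x : growth) A : set_val x A ->
  nbhs x [set y : growth | set_val y A].
Proof.
move=> xA; have xV : nbhs x (set_val @^-1` [set z : cube | z A = set_val x A]).
  exact: (@initial_continuous _ _ set_val x _ (nbhs_coordinate _ A)).
by apply: (@filterS _ (nbhs x) _ _ _ _ xV) => y /= ->.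
Qed.

(** The sets defined by determined [A] with [x] in them generate a filter; it converges to [x]
    because it does so in each coordinate [B], using [B] or its complement. *)
Lemma nbhs_growthP (x : growth) W : nbhs x W ->
  exists2 A, determined R A /\ set_val x A &
    forall y : growth, set_val y A -> W y.
Proof.
case=> _ [[V oV <-] Vx VW].
pose F : set_system cube := [set S | exists2 A, determined R A /\ set_val x A &
    forall y : growth, set_val y A -> S (set_val y)].
have gx : growth (set_val x) by exact: set_valP.
have FF : Filter F.
  split.
  - by exists setT; [split; [exact: determinedT|exact: growthT]|].
  - move=> S S' [A [dA xA] AS] [B [dB xB] BS].
    exists (A `&` B); first by split; [exact: determinedI|rewrite growthI// xA].
    move=> y; rewrite growthI//; last exact: set_valP.
    by move=> /andP[/AS Sy /BS Sy'].
  - by move=> S S' SS' [A Ax AS]; exists A => // y /AS /SS'.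
have Fx : F --> (set_val x : cube).
  apply/cvg_sup => B S [_ [[Q oQ <-] Qx QS]].
  have FB : F [set z : cube | z B = set_val x B].
    have [xB|xB] := boolP (set_val x B).
      exists B => //; split => //; exact: growth_determined xB.
    have [dB|ndB] := pselect (determined R B).
      exists (~` B); first by split; [exact: determinedC|rewrite growthC].
      move=> y; rewrite growthC//; last exact: set_valP.
      by move=> /negbTE yB; rewrite /= yB.
    (* Undetermined coordinates are constantly false, so the whole space serves. *)
    have nB (y : growth) : set_val y B = false.
      by apply/negP => /growth_determined-/(_ (@set_valP _ _ y)).
    by exists setT => [|y _ /=]; [split; [exact: determinedT|exact: growthT]|rewrite !nB].
  apply: filterS FB => z zB; apply: QS; rewrite /= zB; exact: Qx.
have [A Ax AV] := Fx _ (open_nbhs_nbhs (conj oV Vx)).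
by exists A => // y /AV/VW.
Qed.

Lemma growth_compact : compact [set: growth].
Proof.
apply: compact_set_type; apply: (@subclosed_compact _ _ [set: cube]) => //.
  exact: closed_closure.
have := @tychonoff _ (fun _ : set nat => bool) _ (fun=> bool_compact).
by congr (compact _); rewrite eqEsubset.
Qed.

Lemma growth_hausdorff : hausdorff_space growth.
Proof.
by apply/hausdorff_set_type/hausdorff_product => A; exact: discrete_hausdorff.
Qed.

Lemma emb_coordinate n A : determined R A -> set_val (emb n) A = `[< A n >].
Proof. exact: codeE. Qed.

Lemma emb_embedding : topological_embedding emb.
Proof.
split.
- move=> n m nm; have : set_val (emb n) [set m].
    by rewrite nm emb_coordinate; [exact/asboolP|exact: determined_set1].
  by rewrite emb_coordinate; [move/asboolP|exact: determined_set1].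
- move=> n W Wn; apply: (@filterS _ (nbhs n) _ [set n]) (discrete_set1 n) => _ ->.
  exact: (@nbhs_singleton _ (emb n) W Wn).
- move=> A _; exists [set y : growth | exists2 n, A n & set_val y [set n]].
    rewrite openE => y [n An yn]; apply: filterS (nbhs_growth_coordinate yn) => z zn.
    by exists n.
  apply/seteqP; split=> [n [m Am]|n An].
    by rewrite emb_coordinate => [/asboolP->//|]; exact: determined_set1.
  exists n => //; rewrite emb_coordinate; [exact/asboolP|exact: determined_set1].
Qed.

Lemma emb_dense : dense (range emb).
Proof.
move=> W [x Wx] oW; have [A [dA xA] AW] := nbhs_growthP (open_nbhs_nbhs (conj oW Wx)).
have [n [xE _ _]] := @growth_code3 (set_val x) A A A (set_valP x).
exists (emb n); split; last by exists n.
by apply: AW; move: xA; rewrite xE.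
Qed.

Definition nat_growth : nat_compactification :=
  NatCompactification growth_compact growth_hausdorff emb_embedding emb_dense.

(** * Smoothness *)

(** Bad indices would accumulate at some [x]. Near [x], on a determined [A], [f] is within [e / 3]
    of [f x]; for large [n] in [A] the complement of [A] has tiny mean, so [mean n u] is within
    [2 * e / 3] of [f x]. *)
Lemma nat_growth_smooth : smooth R nat_growth.
Proof.
apply: (@smooth_of_asymptotic R nat_growth (@mean R)).
- exact: mean_linear.
- exact: mean_bounded.
- exact: mean_c0.
move=> f; apply/cvgr0Pnorm_le => e e0; apply: contrapT => nf.
pose u := f \o emb; pose M := contfun_norm f.
have uM k : `|u k| <= M by exact: contfun_norm_ge.
have [|x _ Px] := @remainder_accumulation nat_growth
    [set n | ~ (`|u n - mean n u| <= e)].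
  move=> N; apply: contrapT => nP; apply: nf; exists N => // n /= Nn.
  by apply: contrapT => en; apply: nP; exists n.
have e3 : 0 < e / 3 by rewrite divr_gt0.
have /cvgrPdist_le/(_ _ e3)/nbhs_growthP[A [dA xA] Af] :=
  @contfun_continuous _ _ _ f x.
(* [K] dominates [M + |c|] for both one-sided bounds [c] below; adding 1 keeps the divisor
   positive. *)
pose K := M + `|f x + e / 3| + `|- f x + e / 3|.
have K0 : 0 <= K by rewrite !addr_ge0// contfun_norm_ge0.
have d0 : 0 < e / 3 / (K + 1) by rewrite divr_gt0// ltr_wpDl.
have [N _ HN] := dA _ d0.
have [n Nn [/= nn An]] := Px _ N (nbhs_growth_coordinate xA).
apply: nn.
have {}An : A n by move: An; rewrite emb_coordinate// => /asboolP.
have [/(_ An) mA _] := HN n Nn.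
have Ak k : A k -> `|f x - u k| <= e / 3.
  by move=> Ak; apply: Af; rewrite emb_coordinate//; exact/asboolP.
have mA0 : 0 <= mean n (\1_(~` A) : nat -> R).
  rewrite -[leLHS](mean_cst n); apply: (@mean_mono _ _ _ _ 1) => k.
  - by rewrite normr0.
  - exact: indic_bounded.
  - by rewrite indicE.
have mK c : `|c| + M <= K -> (M + `|c|) * mean n \1_(~` A) <= e / 3.
  move=> cK; rewrite (@le_trans _ _ ((K + 1) * mean n \1_(~` A)))//.
    by rewrite ler_wpM2r// addrC (le_trans cK)// lerDl.
  by rewrite mulrC -ler_pdivlMr// ltr_wpDl.
have up : mean n u <= e / 3 + (f x + e / 3).
  apply: (le_trans (@mean_le_on _ n A u M (f x + e / 3) uM _)).
    by move=> k /Ak; rewrite ler_distlC => /andP[]; lra.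
  by rewrite lerD2r mK// addrC lerDl.
have dn : - mean n u <= e / 3 + (- f x + e / 3).
  rewrite -(mean_opp n uM).
  apply: (le_trans (@mean_le_on _ n A _ M (- f x + e / 3) _ _)).
  - by move=> k; rewrite normrN.
  - by move=> k /Ak; rewrite ler_distlC => /andP[]; lra.
  - by rewrite lerD2r mK// addrC /K [leRHS]addrAC lerDl.
have := Ak n An; rewrite ler_distlC ler_norml => /andP[un1 un2].
by apply/andP; split; lra.
Qed.

(** * Non-separability of the remainder *)

Lemma growth_residue (y : cube) i : growth y ->
  exists a, y [set m | m = a %[mod i`!]].
Proof.
move=> gy; pose s := [seq [set m | m = a %[mod i`!]] | a <- iota 0 i`!].
have [n H] := growth_code s gy.
exists (n %% i`!)%N; rewrite H; last first.
  by apply/mapP; exists (n %% i`!)%N => //; rewrite mem_iota add0n ltn_pmod ?fact_gt0.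
rewrite codeE; last exact: determined_residue.
by apply/asboolP; rewrite /= modn_mod.
Qed.

Lemma residue_sparse_union (y : cube) (a : nat -> nat) i : growth y ->
  ~ range code y -> (2 < i)%N -> y [set m | m = a i %[mod i`!]] ->
  ~~ y (~` sparse_union a).
Proof.
move=> gy ny i2 yi; apply/negP => yU.
(* The singletons exclude codes of [n] with n + 1 < i!, for which the class is not yet in the union:
   such a code would equal [y]. *)
pose s := [:: [set m | m = a i %[mod i`!]], ~` sparse_union a &
  [seq [set m] | m <- iota 0 i`!]].
have [n H] := growth_code s gy.
move: yi yU; rewrite (H _ (mem_head _ _)) H; last by rewrite !inE eqxx orbT.
move=> /asboolP[_ ni] /asboolP[_]; apply; exists i; split => //.
rewrite leqNgt; apply/negP => ni'; apply: ny; exists n => //.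
apply/esym/growth_set1 => //; rewrite H.
  by rewrite codeE; [exact/asboolP|exact: determined_set1].
rewrite !inE; apply/orP; right; apply/orP; right; apply/mapP; exists n => //.
by rewrite mem_iota add0n/= ltnW.
Qed.

Lemma nat_growth_remainder_nonseparable : ~ separable (remainder nat_growth).
Proof.
move=> [D /countable_injP[phi phi_inj] dD].
have [a Da] : {a : nat -> nat | forall x : remainder nat_growth, D x ->
    (set_val (set_val x) : cube) [set m | m = a (phi x + 3)%N %[mod (phi x + 3)`!]]}.
  suff H (i : nat) : exists b : nat, forall x : remainder nat_growth, D x ->
      (phi x + 3)%N = i -> (set_val (set_val x) : cube) [set m | m = b %[mod i`!]].
    by have [a Ha] := choice H; exists a => x Dx; exact: Ha.
  have [[x [Dx <-]]|nx] := pselect (exists x, D x /\ (phi x + 3)%N = i).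
    have [b xb] := growth_residue (phi x + 3) (set_valP (set_val x)).
    exists b => z Dz /addIn zx; suff -> : z = x by [].
    by apply: phi_inj => //; exact/mem_set.
  by exists 0%N => x Dx xi; exfalso; apply: nx; exists x.
pose C := ~` sparse_union a.
have dC : determined R C by exact/determinedC/determined_sparse_union.
(* The infinite complement of the union accumulates in the remainder, which makes the open set [W]
   below nonempty. *)
have [x rx Px] := @remainder_accumulation nat_growth C (sparse_unionC_infinite R a).
have xC : set_val x C.
  apply/negPn; rewrite -growthC//; last exact: set_valP.
  apply/negP => /nbhs_growth_coordinate/(Px _ 0%N)[n _ [Cn /=]].
  by rewrite emb_coordinate; [move/asboolP; apply|exact: determinedC].
pose W := [set z : remainder nat_growth | set_val (set_val z) C].
have oW : open W.
  rewrite openE => z /= zC.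
  exact: (@initial_continuous _ _ set_val z _ (nbhs_growth_coordinate zC)).
have [|z [/= zC Dz]] := dD W _ oW.
  by exists (exist _ x (mem_set rx)).
have := @residue_sparse_union (set_val (set_val z)) a (phi z + 3)
  (set_valP (set_val z)).
rewrite zC; suff nz : ~ range code (set_val (set_val z)).
  by move=> /(_ nz); rewrite addn3 => /(_ isT); rewrite -addn3 => /(_ (Da z Dz)).
by case=> n _ nz; have := set_valP z; apply; exists n => //; exact: val_inj.
Qed.

End compactification.

Theorem theorem6p1 (R : realType) :
  continuum_hypothesis ->
  exists g : nat_compactification, smooth R g /\ ~ separable (remainder g).
Proof.
move=> _; exists (nat_growth R); split; first exact: nat_growth_smooth.
exact: nat_growth_remainder_nonseparable.
Qed.
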